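(* Let $\mathbf{g}$ be a simple finite-dimensional complex Lie algebra and $P=\mathbf{g}[u]$. Let $\mathbf{D}_4(P)=\mathbf{g}((u^{-1}))\oplus(\mathbf{g}\otimes\mathbb{C}[\varepsilon])$, $\varepsilon^2=0$, with the invariant form $Q$, the embedding $i:P\to\mathbf{D}_4(P)$ and the complementary Lagrangian subalgebra $P^*=\mathbf{g}[[u^{-1}]]\oplus\mathbf{g}\varepsilon$ described in the context. Then the double $\mathbf{D}_4(P)$ (with this decomposition $\mathbf{D}_4(P)=i(P)\oplus P^*$) corresponds to the Lie co-bracket $\delta_4:P\to P\otimes P$ on $P$ given by $$\delta_4(p(u))=[\Gamma_4(u,v),\,p(u)\otimes 1+1\otimes p(v)],\qquad \Gamma_4(u,v)=\frac{uv\,\Omega}{v-u}.$$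
   Context: $K$ is the Killing form of $\mathbf{g}$, extended $\mathbb{C}((u^{-1}))$-bilinearly to $\mathbf{g}((u^{-1}))$. $\{I_i\}$ is a basis of $\mathbf{g}$ orthonormal with respect to $K$, and $\Omega=\sum_i I_i\otimes I_i\in\mathbf{g}\otimes\mathbf{g}$ is the Casimir element. Elements of $P\otimes P$ are viewed as elements of $(\mathbf{g}\otimes\mathbf{g})[u,v]$. $\mathbf{D}_4(P)$ is a direct sum of Lie algebras. The symmetric nondegenerate invariant form $Q$ on it is $$Q(f(u)+A_0+A_1\varepsilon,\ g(u)+B_0+B_1\varepsilon)=\mathrm{Res}_{u=0}\,u^{-2}K(f,g)-K(A_0,B_1)-K(A_1,B_0),$$ where $f,g\in\mathbf{g}((u^{-1}))$, $A_i,B_i\in\mathbf{g}$, and $\mathrm{Res}_{u=0}$ denotes the coefficient of $u^{-1}$ (so the first term is the coefficient of $u^{1}$ in $K(f,g)$). The embedding $i:P\to\mathbf{D}_4(P)$ is $i(\sum_{k=0}^N c_ku^k)=\sum_{k=0}^N c_ku^k+(c_0+c_1\varepsilon)$, where the first summand lies in $\mathbf{g}((u^{-1}))$ and the second in $\mathbf{g}\otimes\mathbb{C}[\varepsilon]$. The subalgebras $i(P)$ and $P^*=\mathbf{g}[[u^{-1}]]\oplus\mathbf{g}\varepsilon$ are Lagrangian for $Q$, and $\mathbf{D}_4(P)=i(P)\oplus P^*$ as vector spaces; $Q$ identifies $\mathbf{g}[[u^{-1}]]\oplus\mathbf{g}\varepsilon$ with the dual space of $P$. A double $D=P\oplus P^*$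 (with form $Q$ and complementary Lagrangian subalgebras $P,P^*$) corresponds to a co-bracket $\delta:P\to P\otimes P$ when $\delta$ is dual to the Lie bracket of $P^*$. The sign convention is: $(Q\otimes Q)(\delta(a),\,g\otimes f)=Q(a,[f,g])$ for all $a\in P$ and $f,g\in P^*$, where $(Q\otimes Q)(x\otimes y,g\otimes f)=Q(x,g)Q(y,f)$. *)

(* Defs.v *)
From HB Require Import structures.
From mathcomp Require Import all_boot all_order all_algebra.
From mathcomp Require Import complex.
From mathcomp Require Import mathcomp_extra boolp classical_sets functions.
From mathcomp Require Import cardinality fsbigop reals.

Set Implicit Arguments.
Unset Strict Implicit.
Unset Printing Implicit Defensive.

Import Order.TTheory GRing.Theory Num.Theory passmx.
Local Open Scope ring_scope.

Section LieAlgebras.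
Variable F : fieldType.

Definition is_lie_bracket (V : lmodType F) (br : V -> V -> V) : Prop :=
  [/\ (forall a x y z, br (a *: x + y) z = a *: br x z + br y z),
      (forall a x y z, br z (a *: x + y) = a *: br z x + br z y),
      (forall x, br x x = 0) &
      (forall x y z, br x (br y z) + br y (br z x) + br z (br x y) = 0)].

Definition is_simple_lie (g : vectType F) (br : g -> g -> g) : Prop :=
  [/\ is_lie_bracket br,
      (exists x y, br x y <> 0) &
      (forall U : {vspace g}, (forall x y, y \in U -> br x y \in U) ->
         U = 0%VS \/ U = fullv)].

Definition is_invariant_form (V : lmodType F) (br : V -> V -> V)
    (Q : V -> V -> F) : Prop :=
  [/\ (forall a x y z, Q (a *: x + y) z = a * Q x z + Q y z),
      (forall x y, Q x y = Q y x),
      (forall x y z, Q (br x y) z = Q x (br y z)) &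
      (forall x, (forall y, Q x y = 0) -> x = 0)].

Definition is_lagrangian_subalgebra (V : lmodType F) (br : V -> V -> V)
    (Q : V -> V -> F) (A : set V) : Prop :=
  [/\ A 0,
      (forall a x y, A x -> A y -> A (a *: x + y)),
      (forall x y, A x -> A y -> A (br x y)) &
      (forall x, A x <-> forall y, A y -> Q x y = 0)].

Definition is_direct_sum (V : lmodType F) (A B : set V) : Prop :=
  forall x : V, exists! ab : V * V, [/\ A ab.1, B ab.2 & x = ab.1 + ab.2].

End LieAlgebras.

Section Laurent.
Variable F : fieldType.

(* The space V((u^-1)): a series is its coefficient function int -> V, which
   vanishes at all sufficiently large exponents of u. *)
Definition laurent_pred (V : lmodType F) : {pred int -> V} :=
  fun f => `[< exists N : int, forall n, N < n -> f n = 0 >].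

Fact laurent_submod_closed (V : lmodType F) : submod_closed (@laurent_pred V).
Proof.
split; first by apply/asboolP; exists 0.
move=> a f h /asboolP[N fN] /asboolP[M hM]; apply/asboolP.
exists (Num.max N M) => n; rewrite gt_max => /andP[Nn Mn].
by rewrite /GRing.add /= /GRing.scale /= fN // hM // scaler0 addr0.
Qed.

HB.instance Definition _ (V : lmodType F) :=
  GRing.isSubmodClosed.Build F (int -> V) (@laurent_pred V)
    (laurent_submod_closed V).

Record laurent (V : lmodType F) := Laurent {
  lcoef :> int -> V;
  lcoefP : lcoef \in @laurent_pred V }.

HB.instance Definition _ (V : lmodType F) := [isSub for @lcoef V].
HB.instance Definition _ (V : lmodType F) := [Choice of laurent V by <:].
HB.instance Definition _ (V : lmodType F) :=
  [SubChoice_isSubLmodule of laurent V by <:].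

Variables (U V W : lmodType F) (B : {bilinear U -> V -> W}).

(* The sum has finite support, because f and h are bounded above. *)
Definition laurent_bil_coef (f : laurent U) (h : laurent V) (n : int) : W :=
  \sum_(i \in [set: int]) B (f i) (h (n - i)).

Fact laurent_bil_subproof f h : laurent_bil_coef f h \in @laurent_pred W.
Proof.
have /asboolP[N fN] := lcoefP f; have /asboolP[M hM] := lcoefP h.
apply/asboolP; exists (N + M) => n NMn; apply: fsbig1 => i _.
have [Ni|iN] := ltP N i; first by rewrite fN // linear0l.
by rewrite hM ?linear0r // ltrBrDl (le_lt_trans _ NMn) // lerD2r.
Qed.

(* The F((u^-1))-bilinear extension of B. *)
Definition laurent_bil (f : laurent U) (h : laurent V) : laurent W :=
  Laurent (laurent_bil_subproof f h).

End Laurent.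

Section Killing.
Variables (F : fieldType) (g : vectType F) (br : {bilinear g -> g -> g}).
Local Notation b := (vbasis {:g}).

Definition killing (x y : g) : F^o := \tr (mxof b b (linfun (br x \o br y))).

Fact killing_is_bilinear : bilinear_for *:%R *:%R killing.
Proof.
split=> [y|x] a z1 z2 /=; rewrite /killing.
- have -> : linfun (br (a *: z1 + z2) \o br y) =
      a *: linfun (br z1 \o br y) + linfun (br z2 \o br y).
    by apply/lfunP=> t; do !rewrite lfunE /=; rewrite linearPl.
  by rewrite !linearP.
- have -> : linfun (br x \o br (a *: z1 + z2)) =
      a *: linfun (br x \o br z1) + linfun (br x \o br z2).
    by apply/lfunP=> t; do !rewrite lfunE /=; rewrite linearPl linearPr.
  by rewrite !linearP.
Qed.

HB.instance Definition _ :=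
  bilinear_isBilinear.Build F g g F^o *:%R *:%R killing killing_is_bilinear.

End Killing.

Section BaseChange.
(* L-valued versions of g and of g (x) g, for a commutative ring L over F with
   structure map iota, in the coordinates of the basis e = vbasis {:g}:
   L (x) g is 'rV[L]_(\dim {:g}) and L (x) g (x) g is 'M[L]_(\dim {:g}), the
   entry (i, j) being the coordinate on e_i (x) e_j. *)
Variables (F : fieldType) (g : vectType F) (br : {bilinear g -> g -> g}).
Variables (L : comNzRingType) (iota : F -> L).
Local Notation n := (\dim {:g}).
Local Notation e i := ((vbasis {:g})`_(i : nat)).

Definition lieL (x y : 'rV[L]_n) : 'rV[L]_n :=
  \sum_(i < n) \sum_(j < n)
    (x 0 i * y 0 j) *: map_mx iota (rVof (vbasis {:g}) (br (e i) (e j))).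

Definition tens (x y : 'rV[L]_n) : 'M[L]_n := x^T *m y.

(* [t, x (x) 1 + 1 (x) y] *)
Definition tens_comm (t : 'M[L]_n) (x y : 'rV[L]_n) : 'M[L]_n :=
  \sum_(i < n) \sum_(j < n)
    t i j *: (tens (lieL (delta_mx 0 i) x) (delta_mx 0 j)
              + tens (delta_mx 0 i) (lieL (delta_mx 0 j) y)).

End BaseChange.

Section Currents.
Variables (F : fieldType) (g : vectType F) (br : {bilinear g -> g -> g}).
Local Notation n := (\dim {:g}).
Local Notation e i := ((vbasis {:g})`_(i : nat)).

(* P = g[u], and P (x) P = (g (x) g)[u, v] where u is the outer variable of
   {poly {poly F}} and v the inner one. *)
Definition current := 'rV[{poly F}]_n.
Definition current2 := 'M[{poly {poly F}}]_n.

Definition current_lie : current -> current -> current := lieL br polyC.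

Definition ccoef (p : current) (k : nat) : g :=
  vecof (vbasis {:g}) (map_mx (coefp k) p).

Definition monom (i : 'I_n) (k : nat) : current := 'X^k *: delta_mx 0 i.

Definition at_u (p : current) : 'rV[{poly {poly F}}]_n :=
  map_mx (map_poly polyC) p.
Definition at_v (p : current) : 'rV[{poly {poly F}}]_n := map_mx polyC p.

(* The linear map on P (x) P induced by a bilinear map B on P x P. *)
Definition tens_lift (W : lmodType F) (B : current -> current -> W)
    (s : current2) : W :=
  \sum_(i < n) \sum_(j < n)
    \sum_(k < size (s i j)) \sum_(l < size (s i j)`_k)
      (s i j)`_k`_l *: B (monom i k) (monom j l).

(* Coordinates with respect to the basis e_i u^k of P. *)
Definition cur_coord (p : current) (a : 'I_n * nat) : F := (p 0 a.1)`_(a.2).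
Definition cur2_coord (s : current2) (a b : 'I_n * nat) : F :=
  (s a.1 b.1)`_(a.2)`_(b.2).

(* The coordinates of (delta (x) id) (delta p) in P (x) P (x) P. *)
Definition delta_delta (delta : current -> current2) (p : current)
    (a b c : 'I_n * nat) : F :=
  tens_lift (W := F^o)
    (fun x y => cur2_coord (delta x) a b * cur_coord y c) (delta p).

(* Linearity, skew-symmetry, co-Jacobi identity and the 1-cocycle condition. *)
Definition is_lie_cobracket (delta : current -> current2) : Prop :=
  [/\ (forall (a : F) p q,
         delta (a%:P *: p + q) = a%:P%:P *: delta p + delta q),
      (forall p a b, cur2_coord (delta p) a b = - cur2_coord (delta p) b a),
      (forall p a b c, delta_delta delta p a b c + delta_delta delta p b c a
                       + delta_delta delta p c a b = 0) &
      (forall p q, delta (current_lie p q)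
         = tens_comm br (polyC \o polyC) (delta p) (at_u q) (at_v q)
         - tens_comm br (polyC \o polyC) (delta q) (at_u p) (at_v p))].

End Currents.

Section DoubleD4.
Variables (F : fieldType) (g : vectType F) (br : {bilinear g -> g -> g}).
Local Notation n := (\dim {:g}).
Local Notation K := (killing br).

(* In the second summand, (A0, A1) stands for A0 + A1 eps. *)
Definition D4 : lmodType F := (laurent g * (g * g))%type.

Definition D4_lie (x y : D4) : D4 :=
  (laurent_bil br x.1 y.1,
   (br x.2.1 y.2.1, br x.2.1 y.2.2 + br x.2.2 y.2.1)).

Definition D4_form (x y : D4) : F :=
  laurent_bil K x.1 y.1 1 - K x.2.1 y.2.2 - K x.2.2 y.2.1.

Definition current_laurent_coef (p : current g) (k : int) : g :=
  match k with Posz k' => ccoef p k' | Negz _ => 0 end.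

Fact current_laurent_subproof p :
  current_laurent_coef p \in @laurent_pred F g.
Proof.
apply/asboolP; exists (\max_(i < n) size (p 0%R i))%N%:Z => -[k|//] /= lt_k.
rewrite /ccoef (_ : map_mx _ _ = 0) ?linear0 //; apply/rowP => i.
rewrite !mxE /=; apply: nth_default; apply: ltnW; apply: leq_ltn_trans lt_k.
exact: (leq_bigmax i).
Qed.

Definition current_laurent (p : current g) : laurent g :=
  Laurent (current_laurent_subproof p).

Definition D4_incl (p : current g) : D4 :=
  (current_laurent p, (ccoef p 0, ccoef p 1)).

(* g[[u^-1]] + g eps *)
Definition D4_Pstar : set D4 :=
  [set x | (forall k : int, 0 < k -> (x : D4).1 k = 0) /\ x.2.1 = 0].

Definition D4_is_double : Prop :=
  [/\ is_lie_bracket D4_lie /\ is_invariant_form D4_lie D4_form,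
      [/\ injective D4_incl,
          (forall (a : F) p q,
             D4_incl (a%:P *: p + q) = a *: D4_incl p + D4_incl q) &
          (forall p q,
             D4_incl (current_lie br p q) = D4_lie (D4_incl p) (D4_incl q))],
      is_lagrangian_subalgebra D4_lie D4_form (range D4_incl),
      is_lagrangian_subalgebra D4_lie D4_form D4_Pstar &
      is_direct_sum (range D4_incl) D4_Pstar].

(* (Q (x) Q)(s, x (x) y) *)
Definition D4_form2 (s : current2 g) (x y : D4) : F :=
  tens_lift (W := F^o)
    (fun p q => D4_form (D4_incl p) x * D4_form (D4_incl q) y) s.

Definition D4_corresponds (delta : current g -> current2 g) : Prop :=
  D4_is_double /\
  forall (a : current g) (x y : D4), D4_Pstar x -> D4_Pstar y ->
    D4_form2 (delta a) y x = D4_form (D4_incl a) (D4_lie x y).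

End DoubleD4.

Section Gamma4.
Variables (F : fieldType) (g : vectType F) (br : {bilinear g -> g -> g}).
Local Notation n := (\dim {:g}).

Definition is_orthonormal_basis (I : n.-tuple g) : Prop :=
  basis_of {:g} I /\ forall i j : 'I_n, killing br I`_i I`_j = (i == j)%:R.

Definition casimir (I : n.-tuple g) : 'M[F]_n :=
  \sum_(i < n) tens (rVof (vbasis {:g}) I`_i) (rVof (vbasis {:g}) I`_i).

Definition ratfun := {fraction {poly {poly F}}}.
Definition ratC (c : F) : ratfun := tofrac c%:P%:P.
Definition rat_u : ratfun := tofrac 'X.
Definition rat_v : ratfun := tofrac 'X%:P.

Definition Gamma4 (I : n.-tuple g) : 'M[ratfun]_n :=
  (rat_u * rat_v / (rat_v - rat_u)) *: map_mx ratC (casimir I).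

(* delta p = [Gamma4, p(u) (x) 1 + 1 (x) p(v)], the commutator being computed
   in (g (x) g)(u, v); tofrac is injective, so this determines delta. *)
Definition is_delta4 (I : n.-tuple g) (delta : current g -> current2 g) : Prop :=
  forall p : current g,
    map_mx (@tofrac _) (delta p) =
    tens_comm br ratC (Gamma4 I)
      (map_mx (@tofrac _) (at_u p)) (map_mx (@tofrac _) (at_v p)).

End Gamma4.

(* Main.v *)
(* Write e_i for the chosen basis of g and e^i for its dual basis under the
   Killing form K, so that Omega = sum_i e_i (x) e^i.  Invariance of K gives
   [Omega, c (x) 1] = - [Omega, 1 (x) c] = sum_(i,j) K(c, [e^i, e^j]) e_i (x) e_j,
   hence the commutator with Gamma_4 divides exactly by v - u:
     delta_4(c u^k) = sum_(i,j) K(c, [e^j, e^i])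
                        sum_(r + s = k + 1, r, s >= 1) (e_i u^r) (x) (e_j v^s).
   In other words the coordinate of delta_4(p) on (e_i u^r) (x) (e_j v^s) is
   K(p_(r+s-1), [e^j, e^i]), and 0 if r = 0 or s = 0.  Pairing with P^*, where
   e_i u^r (r >= 1) is dual to e^i u^(1-r) and g is dual to g eps, turns this into
   Q(p, [f, g]); the co-Jacobi identity becomes the Jacobi identity for e^i, e^j,
   e^k, and the cocycle identity that of (g (x) g)(u, v) as a module over P.
   The two summands of D_4(P) are isotropic and span, and for a nondegenerate
   form this already makes them complementary Lagrangians. *)
From HB Require Import structures.
Require Import Defs.
From mathcomp Require Import all_boot all_order all_algebra complex reals.
From mathcomp Require Import boolp classical_sets fsbigop.
From mathcomp Require Import ring zify.

Set Implicit Arguments.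
Unset Strict Implicit.
Unset Printing Implicit Defensive.

Import Order.TTheory GRing.Theory Num.Theory passmx.
Local Open Scope ring_scope.

(** * Lie brackets and the Killing form *)

Section LieBracket.
Variables (F : fieldType) (V : lmodType F) (br : {bilinear V -> V -> V}).
Hypothesis br_lie : is_lie_bracket br.

Lemma lie_anti x y : br x y = - br y x.
Proof.
case: br_lie => _ _ alt _; apply/eqP; rewrite -addr_eq0; apply/eqP.
have := alt (x + y); rewrite linearDl !linearDr !alt add0r addr0.
by rewrite addrC.
Qed.

Lemma lie_jacobi x y z : br x (br y z) + br y (br z x) + br z (br x y) = 0.
Proof. by case: br_lie. Qed.

Lemma lie_ad_bracket x y z : br (br x y) z = br x (br y z) - br y (br x z).
Proof.
have := lie_jacobi x y z; rewrite [br z (br x y)]lie_anti => /eqP.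
rewrite subr_eq0 => /eqP <-.
by rewrite [br z x]lie_anti linearNr.
Qed.

End LieBracket.

Section Killing.
Variables (F : fieldType) (g : vectType F) (br : {bilinear g -> g -> g}).
Hypothesis br_lie : is_lie_bracket br.
Local Notation n := (\dim {:g}).
Local Notation b := (vbasis {:g}).
Local Notation e i := ((vbasis {:g})`_(i : nat)).
Local Notation K := (killing br).

Definition ad_mx (x : g) : 'M[F]_n := mxof b b (linfun (br x)).

Lemma ad_mxE x (i j : 'I_n) : ad_mx x i j = rVof b (br x (e i)) 0 j.
Proof.
have := mul_mxof b b (linfun (br x)) (delta_mx 0 i).
rewrite vecof_delta lfunE /= => <-.
by rewrite -rowE [RHS]mxE.
Qed.

Lemma ad_mx_is_linear : linear ad_mx.
Proof.
move=> a x y; rewrite /ad_mx -linearP; congr mxof; apply/lfunP => z.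
by do !rewrite lfunE /=; rewrite linearPl.
Qed.

HB.instance Definition _ := GRing.isSemilinear.Build F g 'M[F]_n _ ad_mx
  (GRing.semilinear_linear ad_mx_is_linear).

(** Matrices act on row vectors from the right, so composition reverses the order of the product.
    For the same reason [ad_mx] turns brackets into commutators of the opposite sign. *)
Lemma ad_mxM x y : mxof b b (linfun (br x \o br y)) = ad_mx y *m ad_mx x.
Proof.
rewrite /ad_mx -(mxof_comp _ _ (vbasisP _)); congr mxof.
by apply/lfunP => z; do !rewrite lfunE /=.
Qed.

Lemma ad_mx_br x y : ad_mx (br x y) = ad_mx y *m ad_mx x - ad_mx x *m ad_mx y.
Proof.
rewrite -!ad_mxM -linearB /=; congr mxof; apply/lfunP => z.
by do !rewrite lfunE /=; rewrite lie_ad_bracket.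
Qed.

Lemma killingE x y : K x y = \tr (ad_mx x *m ad_mx y).
Proof. by rewrite /killing ad_mxM mxtrace_mulC. Qed.

Lemma killingC x y : K x y = K y x.
Proof. by rewrite !killingE mxtrace_mulC. Qed.

(** With X, Y, Z the three adjoint matrices, cyclicity of the trace identifies tr(YXZ) with tr(XZY);
    the remaining term tr(XYZ) is common to both sides. *)
Lemma killing_inv x y z : K (br x y) z = K x (br y z).
Proof.
rewrite !killingE !ad_mx_br mulmxBl mulmxBr !linearB /=.
by rewrite -!mulmxA mxtrace_mulC -mulmxA.
Qed.

Lemma killingZl a x y : K (a *: x) y = a * K x y.
Proof. exact: linearZl_LR. Qed.

Lemma killingZr a x y : K x (a *: y) = a * K x y.
Proof. exact: linearZr_LR. Qed.

Lemma killingDl x y z : K (x + y) z = K x z + K y z.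
Proof. exact: linearDl. Qed.

Lemma killingDr x y z : K x (y + z) = K x y + K x z.
Proof. exact: linearDr. Qed.

Lemma killingNr x y : K x (- y) = - K x y.
Proof. exact: linearNr. Qed.

Lemma killing_suml J (r : seq J) (P : pred J) E y :
  K (\sum_(i <- r | P i) E i) y = \sum_(i <- r | P i) K (E i) y.
Proof. exact: linear_sumlz. Qed.

Lemma killing_sumr J (r : seq J) (P : pred J) E x :
  K x (\sum_(i <- r | P i) E i) = \sum_(i <- r | P i) K x (E i).
Proof. exact: linear_sumr. Qed.

Variables (I : n.-tuple g) (I_orth : is_orthonormal_basis br I).

Lemma killing_expand x : x = \sum_(r < n) K x I`_r *: I`_r.
Proof.
have [Ib Io] := I_orth.
have {1}-> := coord_basis Ib (memvf x).
apply: eq_bigr => r _; congr (_ *: _).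
have {2}-> := coord_basis Ib (memvf x).
rewrite killing_suml (bigD1 r) //= killingZl Io eqxx mulr1.
by rewrite big1 ?addr0 // => i ir; rewrite killingZl Io (negPf ir) mulr0.
Qed.

Lemma killing_eq0 x : (forall y, K x y = 0) -> x = 0.
Proof. by move=> x0; rewrite [x]killing_expand big1 // => r _; rewrite x0 scale0r. Qed.

(** This is the K-dual basis e^i of [vbasis]: since I is orthonormal, the coordinate of e^i on I_r
    is K(e^i, I_r), the i-th coordinate of I_r. *)
Definition dual_basis (i : 'I_n) : g := \sum_(r < n) rVof b I`_r 0 i *: I`_r.

Lemma killing_dual x i : K x (dual_basis i) = rVof b x 0 i.
Proof.
rewrite [in RHS](killing_expand x) linear_sum /= summxE killing_sumr.
by apply: eq_bigr => r _; rewrite killingZr linearZ /= !mxE mulrC.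
Qed.

(** Exchanging the sums over r and j exhibits the matrix of Omega as the passage from [vbasis] to
    its dual, that is, as the inverse Gram matrix of K. *)
Lemma dual_basisE i : dual_basis i = \sum_(j < n) casimir I i j *: e j.
Proof.
rewrite /dual_basis.
under eq_bigr => r _ do rewrite [in X in _ *: X](coord_vbasis (memvf I`_r))
  scaler_sumr.
rewrite exchange_big; apply: eq_bigr => j _; rewrite /casimir summxE scaler_suml.
apply: eq_bigr => r _; rewrite scalerA; congr (_ *: _).
by rewrite /tens !mxE big_ord1 !mxE.
Qed.

Lemma casimirC i j : casimir I i j = casimir I j i.
Proof.
rewrite /casimir !summxE; apply: eq_bigr => r _.
by rewrite /tens !mxE !big_ord1 !mxE mulrC.
Qed.

(** The factors [K x (dual_basis i)] are the coordinates of x on e_i. This is the rule for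
    contracting a tensor index. *)
Lemma sum_killing_dual x y :
  \sum_(i < n) K x (dual_basis i) * K (e i) y = K x y.
Proof.
rewrite [x in RHS](coord_vbasis (memvf x)) killing_suml.
apply: eq_bigr => i _.
by rewrite killingZl killing_dual -coord_rVof.
Qed.

End Killing.

(** * Products of Laurent series *)

Section LaurentTheory.
Variable F : fieldType.
Implicit Types (V : lmodType F) (L : int).

Lemma laurent_eqP V (f h : laurent V) : (forall i, f i = h i) -> f = h.
Proof. by move=> fh; apply/val_inj/funext. Qed.

Lemma laurent_linE V (a : F) (f h : laurent V) i :
  (a *: f + h : laurent V) i = a *: f i + h i.
Proof. by []. Qed.

(** An explicit bound on exponents, so that several series can share one and their products become
    sums over ordinals. *)
Definition bounded_by V L (f : laurent V) := forall i, L < i -> f i = 0.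

Lemma laurent_bounded V (f : laurent V) : exists L, bounded_by L f.
Proof. by have /asboolP := lcoefP f. Qed.

Lemma bounded_byW V L L' (f : laurent V) :
  L <= L' -> bounded_by L f -> bounded_by L' f.
Proof. by move=> LL' fL i /(le_lt_trans LL')/fL. Qed.

Lemma laurent_bounded2 V V' (f : laurent V) (h : laurent V') :
  exists L, bounded_by L f /\ bounded_by L h.
Proof.
have [[L fL] [M hM]] := (laurent_bounded f, laurent_bounded h).
exists (Num.max L M); split.
  by apply: bounded_byW fL; rewrite le_max lexx.
by apply: bounded_byW hM; rewrite le_max lexx orbT.
Qed.

Lemma ltz_nat_ex (k : int) : exists m : nat, k < m%:Z.
Proof. by exists `|k|.+1; lia. Qed.

Lemma laurent_bounded3 V V' V'' (f : laurent V) (h : laurent V')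
    (q : laurent V'') :
  exists L, [/\ bounded_by L f, bounded_by L h & bounded_by L q].
Proof.
have [[L [fL hL]] [M qM]] := (laurent_bounded2 f h, laurent_bounded q).
have leL : L <= Num.max L M by rewrite le_max lexx.
exists (Num.max L M); split; [exact: bounded_byW fL | exact: bounded_byW hL |].
by apply: bounded_byW qM; rewrite le_max lexx orbT.
Qed.

Lemma bounded_by_lin V L (a : F) (f h : laurent V) :
  bounded_by L f -> bounded_by L h -> bounded_by L (a *: f + h).
Proof. by move=> fL hL i Li; rewrite laurent_linE fL // hL // scaler0 addr0. Qed.

Section Bilinear.
Variables (U V W : lmodType F) (B : {bilinear U -> V -> W}).

Lemma laurent_bil_bounded L L' (f : laurent U) (h : laurent V) :
  bounded_by L f -> bounded_by L' h -> bounded_by (L + L') (laurent_bil B f h).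
Proof.
move=> fL hL' k Lk; apply: fsbig1 => i _.
have [Li|iL] := ltP L i; first by rewrite fL // linear0l.
by rewrite hL' ?linear0r //; lia.
Qed.

(** Exponents are counted down from the top, i = L - a, and the bound on h kills every a > L + L' -
    k. Leaving m free above that value lets one m serve several products. *)
Lemma laurent_bil_sum L L' (f : laurent U) (h : laurent V) k (m : nat) :
    bounded_by L f -> bounded_by L' h -> L + L' - k < m%:Z ->
  laurent_bil B f h k =
  \sum_(a < m) B (f (L - a%:Z)) (h (k - (L - a%:Z))).
Proof.
move=> fL hL' km /=; rewrite /laurent_bil_coef.
rewrite (@fsbigE _ _ _ _ _ [seq L - a%:Z | a <- iota 0 m]) //=.
- rewrite big_map; under eq_bigl => i do rewrite in_setT.
  by rewrite -[m in iota 0 m]subn0 big_mkord.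
- by rewrite map_inj_uniq ?iota_uniq // => a c; lia.
- move=> i _ iNr; have [Li|iL] := ltP L i; first by rewrite fL // linear0l.
  rewrite hL' ?linear0r //; rewrite ltNge; apply: contra iNr => iL'.
  by apply/mapP; exists `|L - i|%N; [rewrite mem_iota; lia | lia].
Qed.

Lemma laurent_bil_linl (a : F) (f f' : laurent U) (h : laurent V) :
  laurent_bil B (a *: f + f') h = a *: laurent_bil B f h + laurent_bil B f' h.
Proof.
have [L [fL f'L hL]] := laurent_bounded3 f f' h.
apply: laurent_eqP => k; rewrite laurent_linE.
have [m km] := ltz_nat_ex (L + L - k).
have lL := bounded_by_lin a fL f'L.
rewrite (laurent_bil_sum lL hL km) (laurent_bil_sum fL hL km).
rewrite (laurent_bil_sum f'L hL km) scaler_sumr -big_split.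
by apply: eq_bigr => i _; rewrite laurent_linE linearPl.
Qed.

Lemma laurent_bil_linr (a : F) (f : laurent U) (h h' : laurent V) :
  laurent_bil B f (a *: h + h') = a *: laurent_bil B f h + laurent_bil B f h'.
Proof.
have [L [fL hL h'L]] := laurent_bounded3 f h h'.
apply: laurent_eqP => k; rewrite laurent_linE.
have [m km] := ltz_nat_ex (L + L - k).
have lL := bounded_by_lin a hL h'L.
rewrite (laurent_bil_sum fL lL km) (laurent_bil_sum fL hL km).
rewrite (laurent_bil_sum fL h'L km) scaler_sumr -big_split.
by apply: eq_bigr => i _; rewrite laurent_linE linearPr.
Qed.

(** Trades the exponent k - s for a new index constrained by total degree. If k - s exceeds L, the
    constrained sum is empty and [G 0 = 0] covers the case. *)
Lemma bounded_pick (T : nmodType) L (h : laurent V) (G : V -> T) (k : int)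
    (m : nat) (s : int) : G 0 = 0 -> bounded_by L h -> L - (k - s) < m%:Z ->
  G (h (k - s)) = \sum_(c < m | s + (L - c%:Z) == k) G (h (L - c%:Z)).
Proof.
move=> G0 hL km; have [Lk|kL] := ltP L (k - s).
  by rewrite hL // G0 big_pred0 // => c; apply/negbTE/eqP; lia.
have cm : (`|(L - (k - s))%R|%N < m)%N by lia.
rewrite (big_pred1 (Ordinal cm)) /=; first by congr (G (h _)); lia.
by move=> c; apply/eqP/eqP => [ck|-> /=]; [apply: val_inj => /= | ]; lia.
Qed.

End Bilinear.

Lemma laurent_bil_sum2 (U V W : lmodType F) (B : {bilinear U -> V -> W}) L
    (f : laurent U) (h : laurent V) k (m : nat) :
    bounded_by L f -> bounded_by L h -> L + L - k < m%:Z ->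
  laurent_bil B f h k =
  \sum_(a < m) \sum_(c < m)
     if L - a%:Z + (L - c%:Z) == k then B (f (L - a%:Z)) (h (L - c%:Z)) else 0.
Proof.
move=> fL hL km; rewrite (laurent_bil_sum B fL hL km); apply: eq_bigr => a _.
rewrite -big_mkcond /=.
by apply: (@bounded_pick _ _ _ _ (B (f _))) => //; [exact: linear0r | lia].
Qed.

(** Tied only by their total degree, the three indices play symmetric roles, so permuting the
    factors amounts to permuting summation indices. *)
Lemma laurent_bil_sum3 (U V V' X W : lmodType F) (B : {bilinear U -> X -> W})
    (C : {bilinear V -> V' -> X}) L (f : laurent U) (h : laurent V)
    (q : laurent V') k (m : nat) :
    bounded_by L f -> bounded_by L h -> bounded_by L q ->
    L + L + L - k < m%:Z ->
  laurent_bil B f (laurent_bil C h q) k =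
  \sum_(a < m) \sum_(b < m) \sum_(c < m)
     if L - a%:Z + (L - b%:Z) + (L - c%:Z) == k
     then B (f (L - a%:Z)) (C (h (L - b%:Z)) (q (L - c%:Z))) else 0.
Proof.
move=> fL hL qL km; have hqL := laurent_bil_bounded C hL qL.
have km' : L + (L + L) - k < m%:Z by lia.
rewrite (laurent_bil_sum B fL hqL km'); apply: eq_bigr => a _.
have kam : L + L - (k - (L - a%:Z)) < m%:Z by lia.
rewrite (laurent_bil_sum C hL qL kam) linear_sumr; apply: eq_bigr => b _.
rewrite -big_mkcond -addrA -opprD /=.
apply: (@bounded_pick _ _ _ _ (fun z => B (f _) (C (h _) z))) => //.
  by rewrite !linear0r.
lia.
Qed.

Lemma sum3_rot (T : nmodType) m (H : 'I_m -> 'I_m -> 'I_m -> T) :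
  \sum_a \sum_b \sum_c H a b c = \sum_a \sum_b \sum_c H b c a.
Proof.
rewrite [RHS]exchange_big; apply: eq_bigr => a _.
by rewrite exchange_big.
Qed.

Lemma laurent_lie (V : lmodType F) (br : {bilinear V -> V -> V}) :
  (2 : F) != 0 -> is_lie_bracket br -> is_lie_bracket (laurent_bil br).
Proof.
move=> two_neq0 br_lie; case: (br_lie) => _ _ alt jac.
have anti := lie_anti br_lie.
split; [exact: laurent_bil_linl | by move=> *; exact: laurent_bil_linr | |].
- move=> x; have [L xL] := laurent_bounded x.
  apply: laurent_eqP => k.
  have [m km] := ltz_nat_ex (L + L - k).
  (* Swapping the two summation indices turns the coefficient into its own negative; as 2 is
     nonzero, it vanishes. *)
  have : laurent_bil br x x k = - laurent_bil br x x k.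
    rewrite (laurent_bil_sum2 br xL xL km) [LHS]exchange_big.
    rewrite -sumrN; apply: eq_bigr => a _; rewrite -sumrN.
    by apply: eq_bigr => c _; rewrite addrC anti; case: ifP; rewrite ?oppr0.
  move/eqP; rewrite -addr_eq0 -mulr2n -scaler_nat scaler_eq0 (negPf two_neq0).
  by move/eqP.
- move=> x y z; have [L [xL yL zL]] := laurent_bounded3 x y z.
  apply: laurent_eqP => k.
  have [m km] := ltz_nat_ex (L + L + L - k).
  transitivity (laurent_bil br x (laurent_bil br y z) k
    + laurent_bil br y (laurent_bil br z x) k
    + laurent_bil br z (laurent_bil br x y) k); first by [].
  (* The second triple sum is rotated once and the third twice, so that a, b, c always belong to x,
     y, z; the Jacobi identity then applies term by term. *)
  rewrite (laurent_bil_sum3 br br xL yL zL km).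
  rewrite (laurent_bil_sum3 br br yL zL xL km) [X in _ + X + _]sum3_rot.
  rewrite (laurent_bil_sum3 br br zL xL yL km) [X in _ + X]sum3_rot.
  rewrite [X in _ + X]sum3_rot.
  rewrite -!big_split big1 // => a _; rewrite -!big_split big1 // => b _.
  rewrite -!big_split big1 // => c _ /=.
  set ia := L - a%:Z; set ib := L - b%:Z; set ic := L - c%:Z.
  have -> : ib + ic + ia = ia + ib + ic by rewrite [LHS]addrC addrA.
  have -> : ic + ia + ib = ia + ib + ic by rewrite -[LHS]addrA [LHS]addrC.
  by case: ifP; rewrite ?addr0.
Qed.


End LaurentTheory.

(** * The double *)

Section LaurentForms.
Variable F : fieldType.

Lemma laurent_bil_nonneg (U V W : lmodType F) (B : {bilinear U -> V -> W})
    (f : laurent U) (h : laurent V) (k : nat) :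
    (forall i, i < 0 -> f i = 0) -> (forall i, i < 0 -> h i = 0) ->
  laurent_bil B f h k = \sum_(s < k.+1) B (f s%:Z) (h (k - s)%N%:Z).
Proof.
move=> f0 h0 /=; rewrite /laurent_bil_coef.
rewrite (@fsbigE _ _ _ _ _ [seq Posz a | a <- iota 0 k.+1]) //.
- rewrite big_map; under eq_bigl => i do rewrite in_setT.
  rewrite -[iota 0 k.+1]/(index_iota 0 k.+1) big_mkord; apply: eq_bigr => s _.
  by congr (B _ (h _)); have := ltn_ord s; lia.
- by rewrite map_inj_uniq ?iota_uniq // => a c [].
- move=> i _ iNr; have [i0|i0] := ltP i 0; first by rewrite f0 // linear0l.
  rewrite h0 ?linear0r //; rewrite ltNge; apply: contra iNr => ik.
  by apply/mapP; exists `|i|%N; [rewrite mem_iota; lia | lia].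
Qed.

Lemma laurent_bil_neg (U V W : lmodType F) (B : {bilinear U -> V -> W})
    (f : laurent U) (h : laurent V) (k : int) :
    (forall i, i < 0 -> f i = 0) -> (forall i, i < 0 -> h i = 0) -> k < 0 ->
  laurent_bil B f h k = 0.
Proof.
move=> f0 h0 k0; apply: fsbig1 => i _.
have [i0|i0] := ltP i 0; first by rewrite f0 // linear0l.
by rewrite h0 ?linear0r //; lia.
Qed.

Lemma laurent_bil0r (U V W : lmodType F) (B : {bilinear U -> V -> W})
    (f : laurent U) : laurent_bil B f 0 = 0.
Proof.
by apply: laurent_eqP => k; apply: fsbig1 => i _; exact: linear0r.
Qed.

Lemma laurent_bilC (V W : lmodType F) (B : {bilinear V -> V -> W})
    (f h : laurent V) :
  (forall x y, B x y = B y x) -> laurent_bil B f h = laurent_bil B h f.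
Proof.
move=> BC; have [L [fL hL]] := laurent_bounded2 f h.
apply: laurent_eqP => k; have [m km] := ltz_nat_ex (L + L - k).
rewrite (laurent_bil_sum2 B fL hL km) (laurent_bil_sum2 B hL fL km).
rewrite exchange_big; apply: eq_bigr => a _; apply: eq_bigr => c _.
by rewrite addrC BC.
Qed.

(** Invariance is used in cyclic form because both sides then have the nested product on the right,
    the shape expanded by [laurent_bil_sum3]. *)
Lemma laurent_bil_rot (V W : lmodType F) (B : {bilinear V -> V -> W})
    (br : {bilinear V -> V -> V}) (f h q : laurent V) :
    (forall x y z, B x (br y z) = B z (br x y)) ->
  laurent_bil B f (laurent_bil br h q) = laurent_bil B q (laurent_bil br f h).
Proof.
move=> Brot; have [L [fL hL qL]] := laurent_bounded3 f h q.
apply: laurent_eqP => k; have [m km] := ltz_nat_ex (L + L + L - k).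
rewrite (laurent_bil_sum3 B br fL hL qL km).
rewrite (laurent_bil_sum3 B br qL fL hL km) sum3_rot.
apply: eq_bigr => a _; apply: eq_bigr => b _; apply: eq_bigr => c _.
set ia := L - a%:Z; set ib := L - b%:Z; set ic := L - c%:Z.
have -> : ib + ic + ia = ia + ib + ic by rewrite [LHS]addrC addrA.
by rewrite Brot.
Qed.

Fact laurent_mono_subproof (V : lmodType F) (z : V) (k : int) :
  (fun i : int => if i == k then z else 0) \in @laurent_pred F V.
Proof. by apply/asboolP; exists k => i ki; case: eqP => // ik; lia. Qed.

(** Serves as test vector for nondegeneracy of [D4_form] and as image of the monomials of P. *)
Definition laurent_mono (V : lmodType F) (z : V) (k : int) : laurent V :=
  Laurent (laurent_mono_subproof z k).

Lemma laurent_bil_mono (U V W : lmodType F) (B : {bilinear U -> V -> W})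
    (f : laurent U) (z : V) (i k : int) :
  laurent_bil B f (laurent_mono z k) i = B (f (i - k)) z.
Proof.
rewrite /= /laurent_bil_coef (@fsbigE _ _ _ _ _ [:: i - k]) //=.
- rewrite big_mkcond big_seq1 in_setT; congr (B _ _).
  by case: eqP => //; lia.
- move=> j _; rewrite inE => /eqP jk; case: eqP => [?|_]; first lia.
  exact: linear0r.
Qed.

End LaurentForms.

(** * Complementary isotropic subspaces for a nondegenerate form *)

Section Lagrangian.
Variables (F : fieldType) (V : lmodType F) (br : V -> V -> V) (Q : V -> V -> F).
Hypothesis Q_inv : is_invariant_form br Q.
Variables A B : set V.
Hypotheses (A0 : A 0) (AP : forall a x y, A x -> A y -> A (a *: x + y)).
Hypotheses (B0 : B 0) (BP : forall a x y, B x -> B y -> B (a *: x + y)).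
Hypotheses (AA : forall x y, A x -> A y -> Q x y = 0).
Hypotheses (BB : forall x y, B x -> B y -> Q x y = 0).
Hypothesis AB : forall x, exists u v, [/\ A u, B v & x = u + v].

Lemma form_add x y z : Q (x + y) z = Q x z + Q y z.
Proof. by case: Q_inv => lin _ _ _; have := lin 1 x y z; rewrite scale1r mul1r. Qed.

(** A common vector is orthogonal to A and to B, hence to their sum, which is everything. *)
Lemma isotropic_disjoint x : A x -> B x -> x = 0.
Proof.
case: Q_inv => _ sym _ nondeg Ax Bx; apply: nondeg => y.
by have [u [v [Au Bv ->]]] := AB y; rewrite sym form_add AA // BB // addr0.
Qed.

Lemma isotropic_direct_sum : is_direct_sum A B.
Proof.
move=> x; have [u [v [Au Bv ->]]] := AB x; exists (u, v); split=> //= -[u' v'].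
case=> /= Au' Bv' uv.
have dE : u - u' = v' - v.
  by apply/eqP; rewrite subr_eq addrAC eq_sym subr_eq uv addrC.
have Ad : A (u - u') by rewrite addrC -scaleN1r; exact: AP.
have Bd : B (u - u') by rewrite dE addrC -scaleN1r; exact: BP.
have /eqP := isotropic_disjoint Ad Bd; rewrite subr_eq0 => /eqP uu'.
by move/eqP: dE; rewrite uu' subrr eq_sym subr_eq0 => /eqP ->.
Qed.

(** If x = u + v is orthogonal to A, then v is orthogonal to A because u is, and to B because B is
    isotropic; nondegeneracy gives v = 0. *)
Lemma isotropic_lagrangian :
  (forall x y, A x -> A y -> A (br x y)) -> is_lagrangian_subalgebra br Q A.
Proof.
case: (Q_inv) => _ sym _ nondeg Abr; split=> // x; split=> [Ax y Ay|Qx].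
  exact: AA.
have [u [v [Au Bv xE]]] := AB x; suff -> : x = u by [].
suff v0 : v = 0 by rewrite xE v0 addr0.
apply: nondeg => y; have [u' [v' [Au' Bv' ->]]] := AB y.
rewrite sym form_add [Q v' v]BB // addr0.
have := Qx u' Au'; rewrite xE form_add AA // add0r => <-.
exact: sym.
Qed.

End Lagrangian.

(** * Coefficients of currents and of their brackets *)

Section Currents.
Variables (F : fieldType) (g : vectType F) (br : {bilinear g -> g -> g}).
Local Notation n := (\dim {:g}).
Local Notation b := (vbasis {:g}).
Local Notation e i := ((vbasis {:g})`_(i : nat)).
Implicit Types p q : current g.

Lemma ccoefE p k : ccoef p k = \sum_(i < n) (p 0 i)`_k *: e i.
Proof. by rewrite /ccoef /vecof; apply: eq_bigr => i _; rewrite mxE. Qed.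

Lemma rVof_ccoef p k i : rVof b (ccoef p k) 0 i = (p 0 i)`_k.
Proof. by rewrite /ccoef (vecofK (vbasisP _)) mxE. Qed.

Lemma current_eqP p q : (forall k, ccoef p k = ccoef q k) -> p = q.
Proof.
move=> pq; apply/rowP => i; apply/polyP => k.
by rewrite -!rVof_ccoef pq.
Qed.

Lemma ccoef_lin (a : F) p q k :
  ccoef (a%:P *: p + q) k = a *: ccoef p k + ccoef q k.
Proof.
rewrite !ccoefE scaler_sumr -big_split; apply: eq_bigr => i _ /=.
by rewrite !mxE coefD coefCM scalerDl scalerA.
Qed.

(** The bracket is bilinear over polynomials, so its coefficients obey the Cauchy product rule. This
    form can be compared with [laurent_bil_nonneg]. *)
Lemma ccoef_lie p q k :
  ccoef (current_lie br p q) k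
  = \sum_(s < k.+1) br (ccoef p s) (ccoef q (k - s)).
Proof.
have -> : ccoef (current_lie br p q) k
    = \sum_(i < n) \sum_(j < n) (p 0 i * q 0 j)`_k *: br (e i) (e j).
  rewrite /ccoef /current_lie /lieL.
  have -> : forall u : 'rV[{poly F}]_n, map_mx (coefp k) u = \row_a (u 0 a)`_k.
    by move=> u; apply/rowP => a; rewrite !mxE.
  transitivity (vecof b (\sum_(i < n) \sum_(j < n)
      (p 0 i * q 0 j)`_k *: rVof b (br (e i) (e j)))).
    congr vecof; apply/rowP => a; rewrite !(mxE, summxE) coef_sum.
    apply: eq_bigr => i _; rewrite !summxE coef_sum; apply: eq_bigr => j _.
    by rewrite !mxE coefMC.
  rewrite linear_sum; apply: eq_bigr => i _; rewrite linear_sum.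
  by apply: eq_bigr => j _; rewrite linearZ /= (rVofK (vbasisP _)).
under eq_bigr => i _ do under eq_bigr => j _ do rewrite coefM scaler_suml.
under [RHS]eq_bigr => s _ do rewrite !ccoefE linear_sumlz.
rewrite [RHS]exchange_big; apply: eq_bigr => i _; rewrite exchange_big.
apply: eq_bigr => s _; rewrite linear_sumr; apply: eq_bigr => j _.
by rewrite linearZl_LR linearZr_LR /= scalerA.
Qed.

Definition current_of N (c : nat -> g) : current g :=
  \row_i \poly_(k < N) rVof b (c k) 0 i.

Lemma ccoef_current_of N c k :
  ccoef (current_of N c) k = if (k < N)%N then c k else 0.
Proof.
rewrite ccoefE; under eq_bigr => i _ do rewrite mxE coef_poly.
case: ifP => kN; last by apply: big1 => i _; rewrite scale0r.
by rewrite -[RHS](rVofK (vbasisP _)).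
Qed.

Lemma ccoef_bounded p : exists N, forall k, (N <= k)%N -> ccoef p k = 0.
Proof.
exists (\max_(i < n) size (p 0%R i))%N => k Nk; rewrite ccoefE big1 // => i _.
rewrite nth_default ?scale0r //; apply: leq_trans Nk.
exact: (@leq_bigmax _ (fun i => size (p 0 i))).
Qed.

Lemma current_laurent_neg p i : i < 0 -> current_laurent p i = 0.
Proof. by case: i. Qed.

End Currents.

(** * The Lie algebra [D4], its form and its decomposition *)

Section Double.
Variables (F : fieldType) (g : vectType F) (br : {bilinear g -> g -> g}).
Hypotheses (two_neq0 : (2 : F) != 0) (br_lie : is_lie_bracket br).
Variables (I : (\dim {:g}).-tuple g) (I_orth : is_orthonormal_basis br I).
Local Notation K := (killing br).
Local Notation D4 := (D4 g).
Implicit Types p q : current g.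

Lemma D4_lie_is_lie : is_lie_bracket (D4_lie br).
Proof.
have [lin_l lin_r alt jac] := laurent_lie two_neq0 br_lie.
case: (br_lie) => _ _ alt' jac'; have anti := lie_anti br_lie.
split.
- move=> a [x [x0 x1]] [y [y0 y1]] [z [z0 z1]].
  congr (_, (_, _)) => /=; [exact: lin_l | exact: linearPl |].
  by rewrite !linearPl scalerDr addrACA.
- move=> a [x [x0 x1]] [y [y0 y1]] [z [z0 z1]].
  congr (_, (_, _)) => /=; [exact: lin_r | exact: linearPr |].
  by rewrite !linearPr scalerDr addrACA.
- move=> [x [x0 x1]]; congr (_, (_, _)) => /=; [exact: alt | exact: alt' |].
  by rewrite anti addNr.
- move=> [x [x0 x1]] [y [y0 y1]] [z [z0 z1]].
  congr (_, (_, _)) => /=; [exact: jac | exact: jac' |].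
  rewrite !linearDr /=.
  (* The nine terms of first order in eps are grouped by which of z, y, x carries eps; each group is
     one Jacobi sum. *)
  transitivity ((br x0 (br y0 z1) + br y0 (br z1 x0) + br z1 (br x0 y0))
    + (br x0 (br y1 z0) + br y1 (br z0 x0) + br z0 (br x0 y1))
    + (br x1 (br y0 z0) + br y0 (br z0 x1) + br z0 (br x1 y0))).
    by rewrite (AC (3*3*3) ((1*5*9)*(2*6*7)*(3*4*8)))%AC.
  by rewrite !jac' !addr0.
Qed.

Lemma D4_formE (x y : D4) :
  D4_form br x y = laurent_bil K x.1 y.1 1 - K x.2.1 y.2.2 - K x.2.2 y.2.1.
Proof. by []. Qed.

Lemma D4_form_invariant : is_invariant_form (D4_lie br) (D4_form br).
Proof.
have KC := killingC br; have Kinv := killing_inv br_lie.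
split.
- move=> a [x [x0 x1]] [y [y0 y1]] [z [z0 z1]].
  transitivity (laurent_bil K (a *: x + y) z 1 - K (a *: x0 + y0) z1
    - K (a *: x1 + y1) z0); first by [].
  rewrite laurent_bil_linl !killingDl !killingZl !D4_formE; cbn [fst snd].
  move: (laurent_bil K x z) (laurent_bil K y z) => f h.
  by rewrite laurent_linE -[a *: f 1]/(a * f 1); ring.
- move=> [x [x0 x1]] [y [y0 y1]]; rewrite !D4_formE; cbn [fst snd].
  rewrite laurent_bilC // [K x0 _]KC [K x1 _]KC.
  by rewrite addrAC.
- move=> [x [x0 x1]] [y [y0 y1]] [z [z0 z1]].
  transitivity (laurent_bil K (laurent_bil br x y) z 1 - K (br x0 y0) z1
    - K (br x0 y1 + br x1 y0) z0); first by [].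
  transitivity (laurent_bil K x (laurent_bil br y z) 1
    - K x0 (br y0 z1 + br y1 z0) - K x1 (br y0 z0)); last by [].
  (* Symmetry on the left and rotation on the right bring both Laurent terms to K(z, [x, y]). *)
  rewrite [laurent_bil K (laurent_bil _ _ _) _]laurent_bilC //.
  rewrite [in RHS]laurent_bil_rot; last first.
    by move=> u v w; exact: etrans (esym (Kinv _ _ _)) (KC _ _).
  by rewrite killingDl killingDr !Kinv; ring.
- move=> [x [x0 x1]] xQ; congr (_, (_, _)).
  + apply: laurent_eqP => k; apply: (killing_eq0 I_orth) => z.
    (* The form reads the coefficient of u^1, so z u^(1-k) isolates [K (x k) z]. Below, z eps
       isolates the constant part and z the eps part. *)
    have := xQ (laurent_mono z (1 - k), (0, 0)); rewrite D4_formE.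
    cbn [fst snd]; rewrite laurent_bil_mono !linear0r !subr0 => <-.
    by rewrite opprB addrC subrK.
  + apply: (killing_eq0 I_orth) => z; have := xQ (0, (0, z)); rewrite D4_formE.
    cbn [fst snd]; rewrite laurent_bil0r linear0r subr0 sub0r.
    by move/eqP; rewrite oppr_eq0 => /eqP.
  + apply: (killing_eq0 I_orth) => z; have := xQ (0, (z, 0)); rewrite D4_formE.
    cbn [fst snd]; rewrite laurent_bil0r linear0r subr0 sub0r.
    by move/eqP; rewrite oppr_eq0 => /eqP.
Qed.

Lemma D4_incl_lin (a : F) p q :
  D4_incl (a%:P *: p + q) = a *: D4_incl p + D4_incl q.
Proof.
congr (_, (_, _)) => /=; try exact: ccoef_lin.
apply: laurent_eqP => -[k|k]; first exact: ccoef_lin.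
by rewrite laurent_linE /= scaler0 addr0.
Qed.

(** In the second summand the embedding is reduction modulo u^2 with eps written for u, which
    respects brackets. *)
Lemma D4_incl_lie p q :
  D4_incl (current_lie br p q) = D4_lie br (D4_incl p) (D4_incl q).
Proof.
congr (_, (_, _)).
- have [p0 q0] := (current_laurent_neg p, current_laurent_neg q).
  apply: laurent_eqP => -[k|k]; last by rewrite [RHS]laurent_bil_neg.
  rewrite [RHS](laurent_bil_nonneg _ _ p0 q0); exact: ccoef_lie.
- by rewrite ccoef_lie big_ord1.
- by rewrite ccoef_lie big_ord_recl big_ord1.
Qed.

Lemma D4_incl_inj : injective (@D4_incl F g).
Proof.
move=> p q pq; apply: current_eqP => k.
exact: (congr1 (fun x : D4 => x.1 k) pq).
Qed.

(** The coefficient of u^1 in K(p, q) is K(p_0, q_1) + K(p_1, q_0), exactly what the eps terms of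
    the form subtract. *)
Lemma D4_incl_isotropic p q : D4_form br (D4_incl p) (D4_incl q) = 0.
Proof.
have [p0 q0] := (current_laurent_neg p, current_laurent_neg q).
rewrite D4_formE; cbn [fst snd D4_incl].
rewrite (laurent_bil_nonneg _ 1%N p0 q0) big_ord_recl big_ord1 /= .
by rewrite addrAC addrK subrr.
Qed.

Lemma Pstar_bounded (x : D4) : D4_Pstar x -> bounded_by 0 x.1.
Proof. by case. Qed.

(** A product of two series of degree at most 0 has no u^1 term, and the eps terms vanish with the
    constant parts. *)
Lemma Pstar_isotropic (x y : D4) :
  D4_Pstar x -> D4_Pstar y -> D4_form br x y = 0.
Proof.
move=> [x1 x0] [y1 y0]; rewrite D4_formE x0 y0 linear0l linear0r !subr0.
by rewrite (laurent_bil_bounded _ x1 y1).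
Qed.

Lemma Pstar_lin (a : F) (x y : D4) :
  D4_Pstar x -> D4_Pstar y -> D4_Pstar (a *: x + y).
Proof.
move=> [x1 x0] [y1 y0]; split=> [k k0|].
  by rewrite -[LHS]/(a *: x.1 k + y.1 k) x1 // y1 // scaler0 addr0.
by rewrite -[LHS]/(a *: x.2.1 + y.2.1) x0 y0 scaler0 addr0.
Qed.

Lemma Pstar_lie (x y : D4) :
  D4_Pstar x -> D4_Pstar y -> D4_Pstar (D4_lie br x y).
Proof.
move=> [x1 x0] [y1 y0]; split=> [k k0|].
  exact: (laurent_bil_bounded _ x1 y1).
by rewrite -[LHS]/(br x.2.1 y.2.1) x0 linear0l.
Qed.

Lemma D4_decomp (x : D4) :
  exists u v, [/\ range (@D4_incl F g) u, D4_Pstar v & x = u + v].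
Proof.
have [L xL] := laurent_bounded x.1.
(* The constant term must come from the second summand, where P^* has none. The discrepancy with the
   constant term of [x.1] stays in g[[u^-1]], and that of the eps part in g eps. *)
pose c k := if k is 0%N then x.2.1 else x.1 k%:Z.
pose p := current_of `|L|.+2 c.
exists (D4_incl p), (x - D4_incl p); split; first by exists p.
- split=> [k k0|].
    rewrite -[LHS]/(x.1 k - current_laurent p k).
    case: k k0 => // -[|k] // _; rewrite /= ccoef_current_of.
    case: ifP => [_|kL]; first by rewrite subrr.
    by rewrite subr0 xL //; lia.
  rewrite -[LHS]/(x.2.1 - ccoef p 0) ccoef_current_of.
  by rewrite subrr.
- by rewrite addrC subrK.
Qed.

Lemma D4_double : D4_is_double br.
Proof.
have inv := D4_form_invariant.
have incl_lin (a : F) (x y : D4) : range (@D4_incl F g) x ->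
    range (@D4_incl F g) y -> range (@D4_incl F g) (a *: x + y).
  by move=> [p _ <-] [q _ <-]; exists (a%:P *: p + q); rewrite ?D4_incl_lin.
have incl0 : range (@D4_incl F g) 0.
  exists 0 => //; apply: (addIr (D4_incl 0)).
  by rewrite add0r -[X in X + _]scale1r -D4_incl_lin scaler0 addr0.
have incl_iso (x y : D4) : range (@D4_incl F g) x ->
    range (@D4_incl F g) y -> D4_form br x y = 0.
  by move=> [p _ <-] [q _ <-]; exact: D4_incl_isotropic.
have Pstar0 : D4_Pstar (0 : D4) by split.
split.
- by split; [exact: D4_lie_is_lie | exact: inv].
- by split; [exact: D4_incl_inj | exact: D4_incl_lin | exact: D4_incl_lie].
- apply: (isotropic_lagrangian inv incl0 incl_lin incl_iso Pstar_isotropic).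
    exact: D4_decomp.
  by move=> _ _ [p _ <-] [q _ <-]; exists (current_lie br p q);
    rewrite ?D4_incl_lie.
- apply: (isotropic_lagrangian inv Pstar0 Pstar_lin Pstar_isotropic incl_iso).
    by move=> x; have [u [v [? ? ->]]] := D4_decomp x; exists v, u; rewrite addrC.
  exact: Pstar_lie.
- exact: (isotropic_direct_sum inv incl_lin Pstar_lin incl_iso Pstar_isotropic
    D4_decomp).
Qed.

End Double.

(** * The co-bracket *)

Lemma sum_ord_widen (T : nmodType) N M (G : nat -> T) :
    (forall k, (N <= k)%N -> G k = 0) -> (forall k, (M <= k)%N -> G k = 0) ->
  \sum_(k < N) G k = \sum_(k < M) G k.
Proof.
move=> GN GM; have widen P : (P <= N + M)%N ->
    (forall k, (P <= k)%N -> G k = 0) -> \sum_(k < P) G k = \sum_(k < N + M) G k.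
  move=> PNM GP; rewrite (big_ord_widen (N + M) G PNM) big_mkcond.
  by apply: eq_bigr => k _; case: ltnP => // /GP ->.
by rewrite (widen N) ?leq_addr // (widen M) ?leq_addl.
Qed.

(** * Commutators with a tensor as matrix algebra *)

Section BaseChange.
Variables (F : fieldType) (g : vectType F) (br : {bilinear g -> g -> g}).
Hypothesis br_lie : is_lie_bracket br.
Local Notation n := (\dim {:g}).
Local Notation b := (vbasis {:g}).
Local Notation e i := ((vbasis {:g})`_(i : nat)).

Lemma tens_commZ (L : comNzRingType) (iota : F -> L) (s : L) (t : 'M[L]_n)
    (x y : 'rV[L]_n) :
  tens_comm br iota (s *: t) x y = s *: tens_comm br iota t x y.
Proof.
rewrite /tens_comm scaler_sumr; apply: eq_bigr => i _.
by rewrite scaler_sumr; apply: eq_bigr => j _; rewrite scalerA mxE.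
Qed.

Section Map.
Variables (L L' : comNzRingType) (f : {rmorphism L -> L'}).
Variables (iota : F -> L) (iota' : F -> L').
Hypothesis f_iota : forall c, f (iota c) = iota' c.

Lemma map_lieL (x y : 'rV[L]_n) :
  map_mx f (lieL br iota x y) = lieL br iota' (map_mx f x) (map_mx f y).
Proof.
apply/rowP => a; rewrite mxE !summxE rmorph_sum; apply: eq_bigr => i _.
rewrite !summxE rmorph_sum; apply: eq_bigr => j _.
by rewrite !mxE !rmorphM /= f_iota.
Qed.

Lemma map_tens_comm (t : 'M[L]_n) (x y : 'rV[L]_n) :
  map_mx f (tens_comm br iota t x y) =
  tens_comm br iota' (map_mx f t) (map_mx f x) (map_mx f y).
Proof.
rewrite /tens_comm raddf_sum; apply: eq_bigr => i _.
rewrite raddf_sum; apply: eq_bigr => j _.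
by rewrite /= map_mxZ map_mxD /tens !map_mxM -!map_trmx !map_lieL !map_delta_mx !mxE.
Qed.

End Map.

Variables (L : comNzRingType) (iota : {rmorphism F -> L}).

Definition adL (x : 'rV[L]_n) : 'M[L]_n :=
  \sum_(m < n) x 0 m *: map_mx iota (ad_mx br (e m)).

Lemma lieLE (x y : 'rV[L]_n) : lieL br iota x y = y *m adL x.
Proof.
rewrite /adL mulmx_sumr; apply: eq_bigr => i _; apply/rowP => a.
rewrite summxE -scalemxAr [RHS]mxE [X in _ * X]mxE mulr_sumr.
apply: eq_bigr => j _; rewrite [LHS]mxE [X in _ * X = _]mxE.
by rewrite [X in _ = _ * (_ * X)]mxE ad_mxE mulrA.
Qed.

Lemma lieL_anti (x y : 'rV[L]_n) : lieL br iota x y = - lieL br iota y x.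
Proof.
rewrite /lieL exchange_big -sumrN; apply: eq_bigr => i _ /=.
rewrite -sumrN; apply: eq_bigr => j _ /=.
by rewrite mulrC (lie_anti br_lie) linearN map_mxN scalerN.
Qed.

Lemma adL_lie (x y : 'rV[L]_n) :
  adL (lieL br iota x y) = adL y *m adL x - adL x *m adL y.
Proof.
rewrite {1}/adL.
have -> : \sum_(m < n) lieL br iota x y 0 m *: map_mx iota (ad_mx br (e m))
    = \sum_(i < n) \sum_(j < n)
      (x 0 i * y 0 j) *: map_mx iota (ad_mx br (br (e i) (e j))).
  under eq_bigr => m _ do rewrite summxE scaler_suml.
  rewrite exchange_big; apply: eq_bigr => i _ /=.
  under eq_bigr => m _ do rewrite summxE scaler_suml.
  rewrite exchange_big; apply: eq_bigr => j _ /=.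
  rewrite [in RHS](coord_vbasis (memvf (br (e i) (e j)))) linear_sum.
  rewrite raddf_sum scaler_sumr; apply: eq_bigr => m _ /=.
  by rewrite linearZ /= map_mxZ scalerA !mxE.
have adL_mul u v : adL u *m adL v = \sum_(i < n) \sum_(j < n)
    (u 0 i * v 0 j) *: map_mx iota (ad_mx br (e i) *m ad_mx br (e j)).
  rewrite /adL mulmx_suml; apply: eq_bigr => i _; rewrite mulmx_sumr.
  apply: eq_bigr => j _.
  by rewrite -scalemxAl -scalemxAr scalerA map_mxM.
rewrite !adL_mul [X in _ = X - _]exchange_big -sumrB; apply: eq_bigr => i _.
rewrite -sumrB; apply: eq_bigr => j _.
by rewrite (ad_mx_br br_lie) map_mxB scalerBr [y 0 j * _]mulrC.
Qed.

(** Since [e_i, x] = -[x, e_i] is minus row i of [adL x], acting on the first leg multiplies t by a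
    transpose on the left, and on the second leg by a matrix on the right. *)
Lemma tens_commE (t : 'M[L]_n) (x y : 'rV[L]_n) :
  tens_comm br iota t x y = - ((adL x)^T *m t + t *m adL y).
Proof.
have lie_delta i z : lieL br iota (delta_mx 0 i) z = - row i (adL z).
  by rewrite lieL_anti lieLE rowE.
rewrite /tens_comm.
under eq_bigr => i _ do under eq_bigr => j _ do
  rewrite !lie_delta scalerDr.
under eq_bigr => i _ do rewrite big_split /=.
rewrite big_split opprD /=; congr (_ + _); apply/matrixP => c d.
- rewrite !mxE !summxE -sumrN; apply: eq_bigr => i _.
  rewrite summxE (bigD1 d) //= big1 => [|j jd].
    by rewrite /tens !mxE big_ord1 !mxE !eqxx mulr1 addr0 mulrN mulrC.
  by rewrite /tens !mxE big_ord1 !mxE [d == j]eq_sym (negPf jd) andbF !mulr0.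
- rewrite exchange_big !mxE !summxE -sumrN; apply: eq_bigr => j _.
  rewrite summxE (bigD1 c) //= big1 => [|i ic].
    by rewrite /tens !mxE big_ord1 !mxE !eqxx mul1r addr0 mulrN.
  by rewrite /tens !mxE big_ord1 !mxE [c == i]eq_sym (negPf ic) andbF mul0r mulr0.
Qed.

(** This is the module structure of the tensor square, the source of the cocycle identity. The two
    actions are on different sides of t, so the mixed terms cancel. *)
Lemma tens_comm_lie (t : 'M[L]_n) (x y x' y' : 'rV[L]_n) :
  tens_comm br iota t (lieL br iota x x') (lieL br iota y y')
  = tens_comm br iota (tens_comm br iota t x y) x' y'
  - tens_comm br iota (tens_comm br iota t x' y') x y.
Proof.
rewrite !tens_commE !adL_lie linearB /= !trmx_mul.
rewrite !(mulmxBl, mulmxBr, mulmxN, mulNmx, mulmxDl, mulmxDr, mulmxA).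
rewrite !opprK !opprD !opprK.
rewrite [RHS](AC ((2*2)*(2*2)) ((5*1*(8*4))*((2*7)*(3*6))))%AC.
by rewrite /= !subrr !addr0.
Qed.

End BaseChange.

(** * The explicit co-bracket and the Casimir element *)

Section Delta4.
Variables (F : fieldType) (g : vectType F) (br : {bilinear g -> g -> g}).
Hypothesis br_lie : is_lie_bracket br.
Variables (I : (\dim {:g}).-tuple g) (I_orth : is_orthonormal_basis br I).
Local Notation n := (\dim {:g}).
Local Notation b := (vbasis {:g}).
Local Notation e i := ((vbasis {:g})`_(i : nat)).
Local Notation K := (killing br).
Local Notation d i := (dual_basis I i).
Implicit Types p q : current g.

(* [uv (q(v) - q(u)) / (v - u)] *)
Definition divdiff (q : {poly F}) : {poly {poly F}} :=
  \poly_(k < size q) \poly_(l < size q)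
    if (0 < k)%N && (0 < l)%N then q`_(k + l).-1 else 0.

(** Truncating at [size r] loses nothing: if k or l reaches it while both are positive, then k + l -
    1 reaches it too. *)
Lemma coef_divdiff r k l :
  (divdiff r)`_k`_l = if (0 < k)%N && (0 < l)%N then r`_(k + l).-1 else 0.
Proof.
have big_coef m : (size r <= m)%N -> r`_m = 0 by exact: nth_default.
rewrite coef_poly; case: ltnP => kq; last first.
  by rewrite coef0; case: ifP => // /andP[k0 l0]; rewrite big_coef //; lia.
rewrite coef_poly; case: ltnP => // lq.
by case: ifP => // /andP[k0 l0]; rewrite big_coef //; lia.
Qed.

(** At u^k v^l both shifts contribute r_(k+l-2) and cancel, except on the edges k = 1 and l = 1,
    which produce uv r(v) and -uv r(u). *)
Lemma divdiffE (r : {poly F}) :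
  ('X%:P - 'X) * divdiff r = 'X * 'X%:P * (r%:P - map_poly polyC r).
Proof.
apply/polyP => k; apply/polyP => l.
rewrite mulrBl coefB coefCM coefB coefXM coefXM coef_divdiff.
rewrite -mulrA coefXM coefCM.
rewrite !(fun_if (fun p : {poly F} => p`_l)) !coef0 !coefXM coefB coefC.
rewrite coef_map coefB coefC.
case: k => [|k] /=; first by rewrite subr0 if_same.
rewrite coef_divdiff.
case: l => [|l] /=; first by rewrite andbF subr0.
case: k l => [|k] [|l] /=; rewrite ?addnS ?addn0 ?coef0 ?subrr ?subr0 //=.
Qed.

Definition delta4 (p : current g) : current2 g :=
  \matrix_(i, j) \sum_(m < n) (K (e m) (br (d j) (d i)))%:P%:P * divdiff (p 0 m).

Lemma delta4_coef p (a c : 'I_n * nat) :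
  cur2_coord (delta4 p) a c =
  if (0 < a.2)%N && (0 < c.2)%N
  then K (ccoef p (a.2 + c.2).-1) (br (d c.1) (d a.1)) else 0.
Proof.
case: a c => [i k] [j l]; rewrite /cur2_coord mxE /= !coef_sum.
under eq_bigr => m _ do rewrite coefCM coefCM coef_divdiff.
case: ifP => kl; last by apply: big1 => m _; rewrite mulr0.
rewrite ccoefE killing_suml; apply: eq_bigr => m _.
by rewrite killingZl mulrC.
Qed.

Lemma current2_eqP (s t : current2 g) :
  (forall a c, cur2_coord s a c = cur2_coord t a c) -> s = t.
Proof.
move=> st; apply/matrixP => i j; apply/polyP => k; apply/polyP => l.
exact: (st (i, k) (j, l)).
Qed.

Lemma cur2_coord_lin (a : F) (s t : current2 g) c c' :
  cur2_coord (a%:P%:P *: s + t) c c' = a * cur2_coord s c c' + cur2_coord t c c'.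
Proof. by rewrite /cur2_coord !mxE !coefD !coefCM. Qed.

Lemma delta4_lin (a : F) p q :
  delta4 (a%:P *: p + q) = a%:P%:P *: delta4 p + delta4 q.
Proof.
apply: current2_eqP => c c'; rewrite cur2_coord_lin !delta4_coef.
by case: ifP; rewrite ?mulr0 ?addr0 // ccoef_lin killingDl killingZl.
Qed.

Lemma delta4_skew p a c :
  cur2_coord (delta4 p) a c = - cur2_coord (delta4 p) c a.
Proof.
rewrite !delta4_coef andbC addnC; case: ifP; rewrite ?oppr0 // => _.
by rewrite (lie_anti br_lie) killingNr.
Qed.

(** Contracting with Omega replaces e_m by the dual vector d_j, and the i-th coordinate of [x, d_j]
    is K([x, d_j], d_i); invariance moves x out. *)
Lemma ad_mx_casimir x i j :
  \sum_(m < n) ad_mx br x m i * casimir I m j = K x (br (d j) (d i)).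
Proof.
rewrite -killing_inv // killing_dual // dual_basisE linear_sumr linear_sum summxE.
apply: eq_bigr => m _; rewrite ad_mxE linearZr_LR linearZ /= [RHS]mxE.
by rewrite mulrC casimirC.
Qed.

(** Clearing v - u keeps the identity polynomial. The actions of p(u) and p(v) on Omega have
    opposite structure constants, so only p(v) - p(u) enters and [divdiffE] applies. *)
Lemma delta4_comm p :
  ('X%:P - 'X) *: delta4 p = ('X * 'X%:P) *:
    tens_comm br (polyC \o polyC) (map_mx (polyC \o polyC) (casimir I))
      (at_u p) (at_v p).
Proof.
rewrite tens_commE //; apply/matrixP => i j.
rewrite 2!mxE [RHS]mxE [X in _ = _ * X]mxE [X in _ = _ * - X]mxE.
have adLE (z : 'rV_n) k l : adL br (polyC \o polyC) z k l =
    \sum_(m < n) z 0 m * (ad_mx br (e m) k l)%:P%:P.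
  rewrite summxE; apply: eq_bigr => m _; rewrite mxE; congr (_ * _).
  by rewrite [LHS]mxE.
have -> : ((adL br (polyC \o polyC) (at_u p))^T
      *m map_mx (polyC \o polyC) (casimir I)) i j =
    \sum_(m < n) at_u p 0 m * (K (e m) (br (d j) (d i)))%:P%:P.
  rewrite mxE; under eq_bigr => k _ do
    rewrite mxE adLE [map_mx _ _ _ _]mxE mulr_suml.
  rewrite exchange_big; apply: eq_bigr => m _.
  rewrite -ad_mx_casimir !raddf_sum mulr_sumr; apply: eq_bigr => k _ /=.
  by rewrite !polyCM mulrA.
have -> : (map_mx (polyC \o polyC) (casimir I)
      *m adL br (polyC \o polyC) (at_v p)) i j =
    \sum_(m < n) at_v p 0 m * (K (e m) (br (d i) (d j)))%:P%:P.
  rewrite mxE; under eq_bigr => k _ do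
    rewrite adLE [map_mx _ _ _ _]mxE mulr_sumr.
  rewrite exchange_big; apply: eq_bigr => m _.
  rewrite -ad_mx_casimir !raddf_sum mulr_sumr; apply: eq_bigr => k _ /=.
  by rewrite casimirC !polyCM; ring.
rewrite -big_split -sumrN mulr_sumr mulr_sumr; apply: eq_bigr => m _.
rewrite mulrCA divdiffE [br (d i) _]lie_anti // killingNr !polyCN /at_u /at_v.
by rewrite ![map_mx _ _ _ _]mxE /=; ring.
Qed.

End Delta4.

(** * Comparison with the double *)

Section TensLift.
Variables (F : fieldType) (g : vectType F) (W : lmodType F).
Local Notation n := (\dim {:g}).
Variables (B : current g -> current g -> W).

Lemma tens_lift_widen N (s : current2 g) :
    (forall i j k l, (N <= k)%N || (N <= l)%N -> (s i j)`_k`_l = 0) ->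
  tens_lift B s = \sum_(i < n) \sum_(j < n) \sum_(k < N) \sum_(l < N)
    (s i j)`_k`_l *: B (monom i k) (monom j l).
Proof.
move=> sN; apply: eq_bigr => i _; apply: eq_bigr => j _.
transitivity (\sum_(k < size (s i j)) \sum_(l < N)
    (s i j)`_k`_l *: B (monom i k) (monom j l)).
  apply: eq_bigr => k _.
  apply: (@sum_ord_widen _ _ _
    (fun l => (s i j)`_k`_l *: B (monom i k) (monom j l))) => l kl.
    by rewrite nth_default ?scale0r.
  by rewrite sN ?scale0r // kl orbT.
apply: (@sum_ord_widen _ _ _ (fun k => \sum_(l < N)
  (s i j)`_k`_l *: B (monom i k) (monom j l))) => k kl.
  by apply: big1 => l _; rewrite (nth_default _ kl) coef0 scale0r.
by apply: big1 => l _; rewrite sN ?scale0r // kl.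
Qed.

(** The ranges are changed to end exactly at k0 and l0, so that the last term of each sum is the
    surviving one. *)
Lemma tens_lift_supp k0 l0 (s : current2 g) :
    (forall i j k l, B (monom i k) (monom j l) != 0 -> k = k0 /\ l = l0) ->
  tens_lift B s = \sum_(i < n) \sum_(j < n)
    (s i j)`_k0`_l0 *: B (monom i k0) (monom j l0).
Proof.
move=> Bsupp; apply: eq_bigr => i _; apply: eq_bigr => j _.
pose G k l := (s i j)`_k`_l *: B (monom i k) (monom j l).
have G0 k l : (k != k0) || (l != l0) -> G k l = 0.
  rewrite /G; have [->|/Bsupp[-> ->]] := eqVneq (B (monom i k) (monom j l)) 0.
    by rewrite scaler0.
  by rewrite !eqxx.
transitivity (\sum_(k < k0.+1) \sum_(l < l0.+1) G k l); last first.
  rewrite big_ord_recr big1 => [|k _] /=; last first.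
    by apply: big1 => l _; rewrite G0 // ltn_eqF.
  rewrite add0r big_ord_recr big1 => [|l _] /=; last first.
    by rewrite G0 // orbC ltn_eqF.
  by rewrite add0r.
transitivity (\sum_(k < size (s i j)) \sum_(l < l0.+1) G k l).
  apply: eq_bigr => k _; apply: (@sum_ord_widen _ _ _ (G k)) => l kl.
    by rewrite /G nth_default ?scale0r.
  by rewrite G0 // orbC gtn_eqF.
apply: (@sum_ord_widen _ _ _ (fun k => \sum_(l < l0.+1) G k l)) => k kl.
  by apply: big1 => l _; rewrite /G (nth_default _ kl) coef0 scale0r.
by apply: big1 => l _; rewrite G0 // gtn_eqF.
Qed.

End TensLift.

(** Substituting s = k + l, the range is widened to l + N, where G vanishes from N on, and its first
    l terms are dropped. *)
Lemma sum_ord_shift (T : nmodType) N l (G : nat -> T) :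
    (forall s, (N <= s)%N -> G s = 0) ->
  \sum_(k < N) G (k + l)%N = \sum_(s < N) if (l <= s)%N then G s else 0.
Proof.
move=> GN; pose G' s := if (l <= s)%N then G s else 0.
rewrite (@sum_ord_widen _ N (l + N) G'); first last.
- by move=> s ls; rewrite /G' GN ?if_same //; apply: leq_trans ls; rewrite leq_addl.
- by move=> s Ns; rewrite /G' GN ?if_same.
rewrite big_split_ord /=.
rewrite [X in _ = X + _]big1 => [|s _]; last by rewrite /G' leqNgt ltn_ord.
by rewrite add0r; apply: eq_bigr => s _; rewrite /G' leq_addr addnC.
Qed.

(** * Co-bracket axioms and duality with the double *)

Section Main.
Variables (F : fieldType) (g : vectType F) (br : {bilinear g -> g -> g}).
Hypothesis br_lie : is_lie_bracket br.
Variables (I : (\dim {:g}).-tuple g) (I_orth : is_orthonormal_basis br I).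
Local Notation n := (\dim {:g}).
Local Notation b := (vbasis {:g}).
Local Notation e i := ((vbasis {:g})`_(i : nat)).
Local Notation K := (killing br).
Local Notation d i := (dual_basis I i).
Local Notation delta := (delta4 br I).
Implicit Types p q : current g.

Local Notation iota := (polyC \o polyC : F -> {poly {poly F}}).

Lemma v_sub_u_neq0 : 'X%:P - 'X != 0 :> {poly {poly F}}.
Proof.
apply/eqP => /(congr1 (fun r : {poly {poly F}} => r`_1)).
by rewrite coefB coefC coefX !coef0 /= sub0r => /eqP; rewrite oppr_eq0 oner_eq0.
Qed.

Lemma delta4_is_delta4 : is_delta4 br I delta.
Proof.
move=> p; have := congr1 (map_mx (@tofrac _)) (delta4_comm br_lie I_orth p).
rewrite !map_mxZ /= (@map_tens_comm _ _ _ _ _ _ iota (@ratC F)) //.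
rewrite -map_mx_comp.
have -> : map_mx (@tofrac _ \o iota) (casimir I) = map_mx (@ratC F) (casimir I).
  by apply/matrixP => i j; rewrite !mxE.
move=> comm; rewrite /Gamma4 tens_commZ.
have w0 : rat_v F - rat_u F != 0.
  by rewrite /rat_v /rat_u -rmorphB tofrac_eq0 v_sub_u_neq0.
apply: (scalerI w0); rewrite scalerA mulrC divfK //.
rewrite /rat_v /rat_u -rmorphB -rmorphM; exact: comm.
Qed.

Lemma at_u_lie p q : at_u (current_lie br p q) = lieL br iota (at_u p) (at_u q).
Proof. by apply: map_lieL => c; rewrite /= map_polyC. Qed.

Lemma at_v_lie p q : at_v (current_lie br p q) = lieL br iota (at_v p) (at_v q).
Proof. by apply: map_lieL. Qed.

(** After multiplication by v - u, which can be cancelled in a domain, every term is uv times an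
    iterated commutator with Omega, and [tens_comm_lie] concludes. *)
Lemma delta4_cocycle p q :
  delta (current_lie br p q)
  = tens_comm br iota (delta p) (at_u q) (at_v q)
  - tens_comm br iota (delta q) (at_u p) (at_v p).
Proof.
suff: ('X%:P - 'X) *: delta (current_lie br p q) = ('X%:P - 'X) *:
    (tens_comm br iota (delta p) (at_u q) (at_v q)
     - tens_comm br iota (delta q) (at_u p) (at_v p)).
  move=> eq_w; apply/matrixP => i j; apply: (mulfI v_sub_u_neq0).
  by have /matrixP/(_ i j) := eq_w; rewrite mxE => ->; rewrite mxE.
have comm r x y : ('X%:P - 'X) *: tens_comm br iota (delta r) x y =
    ('X * 'X%:P) *: tens_comm br iota (tens_comm br iota
      (map_mx iota (casimir I)) (at_u r) (at_v r)) x y.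
  by rewrite -tens_commZ delta4_comm // tens_commZ.
rewrite delta4_comm // at_u_lie at_v_lie tens_comm_lie // !scalerBr.
by congr (_ - _); rewrite comm.
Qed.

Lemma cur_coord_monom i k c :
  cur_coord (monom i k : current g) c = ((i == c.1) && (k == c.2))%:R.
Proof.
rewrite /cur_coord /monom !mxE /= mulr_natr coefMn coefXn -mulrnA mulnb.
by rewrite [c.2 == k]eq_sym [c.1 == i]eq_sym andbC.
Qed.

Lemma ccoef_monom i k l : ccoef (monom i k : current g) l = (k == l)%:R *: e i.
Proof.
rewrite ccoefE (bigD1 i) //= big1 => [|j ji].
  by rewrite addr0 -[_`__]/(cur_coord (monom i k) (i, l)) cur_coord_monom eqxx.
by rewrite -[_`__]/(cur_coord (monom i k) (j, l)) cur_coord_monom eq_sym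
  (negPf ji) scale0r.
Qed.

(** Only a first leg of degree a.2 + b.2 - 1 can split into degrees a.2 and b.2. Summing over its
    index i contracts the two Killing factors into one nested bracket. *)
Lemma delta_delta4 p a b c :
  delta_delta delta p a b c =
  if [&& 0 < a.2, 0 < b.2 & 0 < c.2]%N
  then K (ccoef p (a.2 + b.2 + c.2).-2) (br (d c.1) (br (d b.1) (d a.1))) else 0.
Proof.
rewrite /delta_delta (@tens_lift_supp _ _ _ _ (a.2 + b.2).-1 c.2); last first.
  move=> i j k l; rewrite delta4_coef cur_coord_monom ccoef_monom.
  case: ifP => [_|]; last by rewrite mul0r eqxx.
  rewrite killingZl; have [->|_] := eqVneq k; last by rewrite !mul0r eqxx.
  by have [->|_] := eqVneq l; rewrite ?andbF ?mulr0 ?eqxx.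
transitivity (\sum_(i < n) cur2_coord (delta p) (i, (a.2 + b.2).-1) c
    * cur2_coord (delta (monom i (a.2 + b.2).-1)) a b).
  apply: eq_bigr => i _; rewrite (bigD1 c.1) //= big1 => [|j jc].
    by rewrite addr0 cur_coord_monom !eqxx mulr1.
  by rewrite cur_coord_monom (negPf jc) mulr0 scaler0.
under eq_bigr => i _ do rewrite !delta4_coef /= ccoef_monom eqxx scale1r.
case: c => l [|c] /=.
  by rewrite !andbF big1 // => i _; rewrite ?andbF mul0r.
(* When a.2 and b.2 are positive, so is a.2 + b.2 - 1, hence the positivity test on the first leg
   succeeds. *)
case: a b => i [|k] [j [|m]] /=;
  try by rewrite ?andbF big1 // => r _; rewrite ?andbF mulr0.
rewrite !addnS /=.
under eq_bigr => r _ do rewrite -killing_inv //.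
by rewrite (sum_killing_dual I_orth) killing_inv.
Qed.

(** Total degree and positivity are invariant under cyclic shifts, leaving the Jacobi identity for
    three dual vectors. *)
Lemma delta4_cojacobi p a b c :
  delta_delta delta p a b c + delta_delta delta p b c a
  + delta_delta delta p c a b = 0.
Proof.
rewrite !delta_delta4.
have -> : (b.2 + c.2 + a.2 = a.2 + b.2 + c.2)%N by rewrite addnC addnA.
have -> : (c.2 + a.2 + b.2 = a.2 + b.2 + c.2)%N by rewrite -addnA addnC.
have -> : [&& 0 < b.2, 0 < c.2 & 0 < a.2]%N = [&& 0 < a.2, 0 < b.2 & 0 < c.2]%N.
  by rewrite andbA andbC.
have -> : [&& 0 < c.2, 0 < a.2 & 0 < b.2]%N = [&& 0 < a.2, 0 < b.2 & 0 < c.2]%N.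
  by rewrite andbC -andbA.
case: ifP => _; last by rewrite !addr0.
rewrite -!killingDr.
have -> : br (d c.1) (br (d b.1) (d a.1)) + br (d a.1) (br (d c.1) (d b.1))
    + br (d b.1) (br (d a.1) (d c.1)) = 0.
  by rewrite addrAC lie_jacobi.
exact: linear0r.
Qed.

Lemma delta4_cobracket : is_lie_cobracket br delta.
Proof.
split; [exact: delta4_lin | exact: delta4_skew | exact: delta4_cojacobi |].
exact: delta4_cocycle.
Qed.

(** For k > 0 both eps terms vanish: the constant parts of the monomial and of x are 0. Hence only
    the coefficient of u^(1-k) is seen. *)
Lemma D4_form_monom i k (x : D4 g) : (0 < k)%N -> D4_Pstar x ->
  D4_form br (D4_incl (monom i k)) x = K (e i) (x.1 (1 - k%:Z)).
Proof.
move=> k0 [_ x0]; rewrite D4_formE x0 [X in _ - X]linear0r subr0.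
cbn [fst snd D4_incl]; rewrite ccoef_monom gtn_eqF // scale0r.
rewrite [X in _ - X]linear0l subr0.
have -> : current_laurent (monom i k) = laurent_mono (e i) k.
  apply: laurent_eqP => -[l|l] //=; rewrite ccoef_monom eq_sym.
  by rewrite eqz_nat; case: eqP; rewrite ?scale1r ?scale0r.
by rewrite laurent_bilC ?laurent_bil_mono; [exact: killingC | exact: killingC].
Qed.

Lemma sum_killing_dual2 z x y :
  \sum_(i < n) \sum_(j < n) K z (br (d j) (d i)) * (K (e i) y * K (e j) x)
  = K z (br x y).
Proof.
rewrite exchange_big /=.
transitivity (\sum_(j < n) K (br y z) (d j) * K (e j) x).
  apply: eq_bigr => j _.
  transitivity ((\sum_(i < n) K (br z (d j)) (d i) * K (e i) y) * K (e j) x).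
    by rewrite mulr_suml; apply: eq_bigr => i _; rewrite mulrA killing_inv.
  rewrite (sum_killing_dual I_orth); congr (_ * _).
  by rewrite killingC -!killing_inv.
rewrite (sum_killing_dual I_orth) killing_inv //.
by rewrite killingC killing_inv.
Qed.

Lemma delta4_dual p (x y : D4 g) : D4_Pstar x -> D4_Pstar y ->
  D4_form2 br (delta p) y x = D4_form br (D4_incl p) (D4_lie br x y).
Proof.
move=> Px Py; have [N pN] := ccoef_bounded p.
have xy_bd := laurent_bil_bounded br (Pstar_bounded Px) (Pstar_bounded Py).
have p_bd : bounded_by N (current_laurent p).
  by move=> [k|k] //= Nk; apply: pN; lia.
(* The common value of both sides. Degrees k + 1 and l + 1 pair with u^(-k) and u^(-l), and the
   coefficient of p has index (k + 1) + (l + 1) - 1. *)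
transitivity (\sum_(k < N) \sum_(l < N)
    K (ccoef p (k + l).+1) (br (x.1 (- l%:Z)) (y.1 (- k%:Z)))).
  (* The range [N.+1] loses its zero term, as [delta4] has no part of degree 0, and shifts back to
     N. *)
  rewrite /D4_form2 (@tens_lift_widen _ _ _ _ N.+1); last first.
    move=> i j k l kl; rewrite -[LHS]/(cur2_coord (delta p) (i, k) (j, l)).
    rewrite delta4_coef /=; case: ifP => // /andP[k0 l0].
    by rewrite pN ?linear0l //; lia.
  transitivity (\sum_(i < n) \sum_(j < n) \sum_(k < N) \sum_(l < N)
      K (ccoef p (k + l).+1) (br (d j) (d i))
      * (K (e i) (y.1 (- k%:Z)) * K (e j) (x.1 (- l%:Z)))).
    apply: eq_bigr => i _; apply: eq_bigr => j _.
    have coef k l := delta4_coef br I p (i, k) (j, l); rewrite /cur2_coord /= in coef.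
    rewrite big_ord_recl big1 ?add0r => [|l _]; last by rewrite coef scale0r.
    apply: eq_bigr => k _.
    rewrite big_ord_recl coef andbF scale0r add0r; apply: eq_bigr => l _.
    rewrite coef !D4_form_monom //= /bump /= !add1n addnS /=.
    by congr (_ * (K _ (y.1 _) * K _ (x.1 _))); lia.
  under eq_bigr => i _ do rewrite exchange_big.
  rewrite exchange_big; apply: eq_bigr => k _.
  under eq_bigr => i _ do rewrite exchange_big.
  rewrite exchange_big; apply: eq_bigr => l _.
  exact: sum_killing_dual2.
(* The constant parts of x and y vanish, so the bracket has neither a constant nor an eps part. *)
transitivity (laurent_bil K (current_laurent p) (laurent_bil br x.1 y.1) 1);
    last first.
  case: Px Py => _ x0 [_ y0]; rewrite D4_formE /D4_lie; cbn [fst snd].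
  rewrite x0 y0 !linear0l linear0r addr0.
  by rewrite [X in _ - X]linear0r [X in _ - X - _]linear0r !subr0.
have p_lt : 0 + 0 + N%:Z - 1 < N%:Z by lia.
(* With the bracket of x and y in front, of degree at most 0, the index s stands for u^(-s), paired
   with p_(s+1). *)
rewrite laurent_bilC; last exact: killingC.
rewrite (laurent_bil_sum _ xy_bd p_bd p_lt).
(* Substitution s = k + l. The terms with s < l are harmless, because there y is evaluated at a
   positive exponent. *)
transitivity (\sum_(s < N) \sum_(l < N)
    K (ccoef p s.+1) (br (x.1 (- l%:Z)) (y.1 (l%:Z - s%:Z)))).
  rewrite exchange_big [RHS]exchange_big; apply: eq_bigr => l _.
  pose G s := K (ccoef p s.+1) (br (x.1 (- l%:Z)) (y.1 (- (s - l)%N%:Z))).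
  transitivity (\sum_(k < N) G (k + l)%N).
    by apply: eq_bigr => k _; rewrite /G addnK.
  rewrite sum_ord_shift => [|s Ns]; last by rewrite /G pN ?linear0l // ltnW.
  apply: eq_bigr => s _; case: leqP => [ls|sl].
    by congr (K _ (br _ (y.1 _))); lia.
  by rewrite (Pstar_bounded Py) ?linear0r //; lia.
apply: eq_bigr => s _; rewrite add0r.
have s_lt : 0 + 0 - - s%:Z < N%:Z by have := ltn_ord s; lia.
rewrite (laurent_bil_sum _ (Pstar_bounded Px) (Pstar_bounded Py) s_lt).
rewrite [RHS]killingC.
rewrite opprK -[1 + s%:Z]/(Posz s.+1) /= killing_sumr; apply: eq_bigr => l _.
by rewrite sub0r opprK [- _ + _]addrC.
Qed.

End Main.

Theorem theorem1 (R : realType) (g : vectType R[i])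
    (br : {bilinear g -> g -> g}) (hg : is_simple_lie br)
    (I : (\dim {:g}).-tuple g) (hI : is_orthonormal_basis br I) :
  exists delta4 : current g -> current2 g,
    [/\ is_delta4 br I delta4, is_lie_cobracket br delta4 &
        D4_corresponds br delta4].
Proof.
have [br_lie _ _] := hg.
have two_neq0 : (2 : R[i]) != 0 by rewrite pnatr_eq0.
exists (delta4 br I); split.
- exact: delta4_is_delta4.
- exact: delta4_cobracket.
- by split=> [|a x y Px Py]; [exact: D4_double hI | exact: delta4_dual].
Qed.
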